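(* For every integer $n\ge 3$, the covering radius of the natural dihedral group $D_n\subseteq S_n$ with respect to the $l_\infty$-metric satisfies $$n-\left\lfloor\frac{\sqrt{4n+1}+1}{2}\right\rfloor\ge r(D_n)\ge n-\left\lfloor\frac{\sqrt{4n+1}+1}{2}\right\rfloor-1.$$ Moreover, if there exists an integer $m>0$ such that $n=m(m-1)$, then $r(D_n)=n-m$.
   Context: For a positive integer $n$, $[n]=\{1,\dots,n\}$ and $S_n$ is the symmetric group on $[n]$. The $l_\infty$-metric on $S_n$ is $d(f,g)=\max_{i\in[n]}|f(i)-g(i)|$. For a nonempty $C\subseteq S_n$ and $f\in S_n$, $d(f,C)=\min_{g\in C}d(f,g)$. The covering radius $r(C)$ is the minimum integer $r$ such that $d(f,C)\le r$ for all $f\in S_n$. The natural dihedral group is $D_n=\left\langle (1,2,\dots,n-1,n),\ \prod_{i=1}^{\lfloor n/2\rfloor}(i,n-i)\right\rangle\subseteq S_n$, in cycle notation (for even $n$ the factor with $i=n/2$ is the identity; thus the second generator maps $i\mapsto n-i$ for $1\le i\le n-1$ and fixes $n$). *)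

(* Defs.v *)
From mathcomp Require Import all_boot all_order all_algebra all_fingroup reals.

Set Implicit Arguments.
Unset Strict Implicit.
Unset Printing Implicit Defensive.

Import Order.TTheory GRing.Theory Num.Theory GroupScope.

(* Convention: the set [n] = {1, ..., n} is 'I_n, the element i : 'I_n standing
   for the label i.+1.  S_n is the permutation group 'S_n. *)

Definition linf_dist n (f g : 'S_n) : nat :=
  (\max_(i < n) `|(f i : nat) - (g i : nat)|)%N.

(* Every distance in 'S_n is at most n (see [linf_dist_le]), so starting the
   iterated minimum at n does not change its value when C is nonempty (see
   [linf_dist_setP]). *)
Definition linf_dist_set n (f : 'S_n) (C : {set 'S_n}) : nat :=
  \big[minn/n]_(g in C) linf_dist f g.

Lemma linf_dist_le n (f g : 'S_n) : (linf_dist f g <= n)%N.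
Proof.
apply/bigmax_leqP => i _.
case: (leqP (f i) (g i)) => h.
  by rewrite distnC distnEl // (leq_trans (leq_subr _ _)) // ltnW.
by rewrite distnEl ?(ltnW h) // (leq_trans (leq_subr _ _)) // ltnW.
Qed.

Lemma linf_dist_setP n (f : 'S_n) (C : {set 'S_n}) : C != set0 ->
  (exists2 g, g \in C & linf_dist_set f C = linf_dist f g) /\
  (forall g, g \in C -> (linf_dist_set f C <= linf_dist f g)%N).
Proof.
case/set0Pn => g0 Cg0.
have lb g : g \in C -> (linf_dist_set f C <= linf_dist f g)%N.
  move=> Cg; have := mem_index_enum g; rewrite /linf_dist_set.
  elim: (index_enum _) => // x s IHs; rewrite inE big_cons.
  case/predU1P => [<-|/IHs le_s]; first by rewrite Cg geq_minl.
  by case: ifP => // _; rewrite geq_min le_s orbT.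
split=> //.
have : linf_dist_set f C = n \/
       exists2 g, g \in C & linf_dist_set f C = linf_dist f g.
  rewrite /linf_dist_set.
  elim/big_ind: _ => [|x y Hx Hy|g Cg]; first by left.
    by rewrite /minn; case: ifP.
  by right; exists g.
case=> // E; exists g0 => //; apply/eqP; rewrite eqn_leq lb //=.
by rewrite E linf_dist_le.
Qed.

Lemma covering_radius_subproof n (C : {set 'S_n}) :
  exists r, [forall f : 'S_n, linf_dist_set f C <= r]%N.
Proof.
exists (\max_(f : 'S_n) linf_dist_set f C)%N.
by apply/forallP => f; apply: leq_bigmax.
Qed.

Definition covering_radius n (C : {set 'S_n}) : nat :=
  ex_minn (covering_radius_subproof C).

(* The cycle (1, 2, ..., n): [ordS] is the cyclic successor on 'I_n. *)
Definition rot_perm n : 'S_n := perm (@ordS_inj n).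

(* The product of the transpositions (i, n - i), 1 <= i <= n / 2, over the
   labels i.+1: for each i the inner product has at most one factor, the one
   with j.+1 = n - i.+1.  The transpositions being disjoint, the order of
   multiplication is irrelevant. *)
Definition refl_perm n : 'S_n :=
  \prod_(i < n | (i.+1 <= n %/ 2)%N)
    \prod_(j < n | (i.+1 + j.+1 == n)%N) tperm i j.

Definition dihedral_perm n : {group 'S_n} :=
  <<[set rot_perm n; refl_perm n]>>%G.

(* Main.v *)
Require Import Defs.
From mathcomp Require Import all_boot all_order all_algebra all_fingroup reals.
From mathcomp Require Import zify lra.

Import Order.TTheory GRing.Theory Num.Theory.
Local Open Scope ring_scope.

(** Modulo n and up to a shift, the elements of D_n are the maps i -> i + s and
    i -> s - i. A permutation f is at distance at least n - m from D_n when every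
    rotation and every reflection g has some i with |f i - g i| >= n - m. There
    are m(m+1) pairs (a, b) with |a - b| >= n - m, and for each pair exactly one
    rotation has b at f^-1 a; so n <= m(m+1). If n = m(m+1), the shifts of these
    rotations tile the circle by arcs, one per value a with
    a < m or a >= n - m, and no arc of the second kind can follow one of the
    first kind, which is absurd since both kinds occur. Hence r(D_n) < n - m whenever n >= m(m+1).
    Conversely, for n = m(m-1) the values a can be put at positions with
    triangular gaps so that the arcs cover the circle, both for rotations and for
    reflections; deleting positions with middle values handles the n between
    (m-1)(m-2) and m(m-1). Finally k = floor ((sqrt (4n+1) + 1) / 2) is the
    integer with k(k-1) <= n < k(k+1). *)

(** * Distances, covering radius and arithmetic modulo [n] *)

Lemma le_linf_dist n d (f g : 'S_n) : (0 < d)%N ->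
  (d <= linf_dist f g)%N = [exists i, d <= `|(f i : nat) - (g i : nat)|]%N.
Proof.
case: d => // d _; apply/idP/existsP => [le_d|[i le_d]]; last first.
  exact: leq_trans le_d (leq_bigmax i).
apply/existsP; apply: contraLR le_d => /existsPn ltd.
by rewrite -leqNgt; apply/bigmax_leqP => i _; have := ltd i; rewrite -leqNgt.
Qed.

Lemma covering_radius_le n (C : {set 'S_n}) r : C != set0 ->
  (covering_radius C <= r)%N <->
  (forall f, exists2 g, g \in C & (linf_dist f g <= r)%N).
Proof.
move=> C0; rewrite /covering_radius; case: ex_minnP => r0 /forallP r0P minr0.
split=> [le_r f|allr].
  have [[g Cg E] _] := linf_dist_setP f C0.
  by exists g => //; rewrite -E (leq_trans (r0P f)).
apply: minr0; apply/forallP => f; have [g Cg le_g] := allr f.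
by have [_ /(_ g Cg)/leq_trans->] := linf_dist_setP f C0.
Qed.

Lemma val_addZp N (x y : 'I_N.+2) :
  (x + y)%R = (if x + y < N.+2 then x + y else x + y - N.+2)%N :> nat.
Proof.
rewrite /=; case: ltnP => [/modn_small//|ge]; have := ltn_ord x; have := ltn_ord y.
by move=> *; rewrite -[in LHS](subnK ge) modnDr modn_small //; lia.
Qed.

Lemma val_oppZp N (x : 'I_N.+2) : (- x)%R = (if x == 0 :> nat then 0 else N.+2 - x)%N :> nat.
Proof.
rewrite /=; case: eqP => [->|/eqP x0]; first by rewrite subn0 modnn.
have: (x != 0 :> nat)%N by []. 
by move=> *; rewrite modn_small //; lia.
Qed.

(** * The dihedral group as rotations and reflections *)

Definition rotations N : {set 'S_N.+2} :=
  [set g : 'S_N.+2 | [exists s, forall i, g i == i + s]].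
Definition reflections N : {set 'S_N.+2} :=
  [set g : 'S_N.+2 | [exists s, forall i, g i == s - i]].

Lemma rotationsP N (g : 'S_N.+2) :
  reflect (exists s, forall i, g i = i + s) (g \in rotations N).
Proof.
rewrite inE; apply: (iffP existsP) => -[s].
  by move/forallP=> h; exists s => i; apply/eqP.
by move=> h; exists s; apply/forallP => i; apply/eqP.
Qed.

Lemma reflectionsP N (g : 'S_N.+2) :
  reflect (exists s, forall i, g i = s - i) (g \in reflections N).
Proof.
rewrite inE; apply: (iffP existsP) => -[s].
  by move/forallP=> h; exists s => i; apply/eqP.
by move=> h; exists s; apply/forallP => i; apply/eqP.
Qed.

Lemma rot_reflM N (g h : 'S_N.+2) :
  g \in rotations N :|: reflections N -> h \in rotations N :|: reflections N ->
  (g * h)%g \in rotations N :|: reflections N.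
Proof.
case/setUP => [/rotationsP|/reflectionsP] [s gs];
  case/setUP => [/rotationsP|/reflectionsP] [t ht]; apply/setUP.
- left; apply/rotationsP; exists (s + t) => i.
  by rewrite permM ht gs addrA.
- right; apply/reflectionsP; exists (t - s) => i.
  by rewrite permM ht gs opprD addrA addrAC.
- right; apply/reflectionsP; exists (s + t) => i.
  by rewrite permM ht gs addrAC.
- left; apply/rotationsP; exists (t - s) => i.
  by rewrite permM ht gs opprB addrC -addrA [- s + t]addrC.
Qed.

Lemma group_set_rot_refl N : group_set (rotations N :|: reflections N).
Proof.
apply/group_setP; split; last exact: rot_reflM.
by rewrite inE; apply/orP; left; apply/rotationsP; exists 0 => i; rewrite perm1 addr0.
Qed.

Lemma rot_permE N (i : 'I_N.+2) : rot_perm N.+2 i = i + 1.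
Proof. by rewrite permE; apply: val_inj; rewrite /= addn1. Qed.

(* The last hypothesis excludes two factors for the same transposition. *)
Lemma prod_tperm_involution (T : finType) (P : pred T) (h : T -> T) (r : seq T) x :
  uniq r -> involutive h -> (forall i, P i -> P (h i) -> h i = i) ->
  (\prod_(i <- r | P i) tperm i (h i))%g x =
  if has (fun i => P i && ((x == i) || (x == h i))) r then h x else x.
Proof.
move=> Ur hK hP; elim: r Ur x => [|i r IHr] /= => [_ x|/andP[i_r Ur] x].
  by rewrite big_nil perm1.
rewrite big_cons; case: ifP => Pi /=; last exact: IHr.
have fixi : has (fun k => P k && ((h i == k) || (h i == h k))) r -> h i = i.
  case/hasP => k kr /andP[Pk /orP[/eqP E|/eqP/(can_inj hK) E]].
    by apply: hP => //; rewrite E.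
  by move: i_r; rewrite E kr.
rewrite permM IHr //; case: tpermP => [->|->|/eqP/negPf-> /eqP/negPf->] //=.
- rewrite eqxx /=; case: ifP => // /fixi E.
  by rewrite !E.
- rewrite eqxx orbT hK; case: ifP => // /hasP[k kr /andP[Pk /orP[/eqP E|/eqP E]]].
    by move: i_r; rewrite E kr.
  have hi : h i = k by rewrite E hK.
  by apply: hP => //; rewrite hi.
Qed.

(** The label [i.+1] goes to the label [n - i.+1], so the index [i] goes to [- 2 - i] modulo [n]. *)
Lemma refl_permE N (x : 'I_N.+2) : refl_perm N.+2 x = - (1 + 1) - x.
Proof.
pose h (i : 'I_N.+2) : 'I_N.+2 := - (1 + 1) - i.
have hK : involutive h by move=> i; rewrite /h opprB addrC addrNK.
have hE (i : 'I_N.+2) : h i = (if i == N.+1 :> nat then N.+1 else N - i)%N :> nat.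
  rewrite /h val_addZp !val_oppZp val_addZp (_ : nat_of_ord (1 : 'I_N.+2) = 1%N) //.
  by have := ltn_ord i; repeat case: ifP; lia.
have -> : refl_perm N.+2 =
    (\prod_(i <- index_enum 'I_N.+2 | (i.+1 <= N.+2 %/ 2)%N) tperm i (h i))%g.
  apply: eq_bigr => i lei; apply: big_pred1 => j /=.
  rewrite -[RHS]/(j == h i :> nat) hE.
  by have := ltn_ord i; have := ltn_ord j; case: ifP; lia.
rewrite prod_tperm_involution ?index_enum_uniq //; last first.
  move=> i; rewrite hE => le1 le2; apply: ord_inj; rewrite hE.
  by have := ltn_ord i; move: le1 le2; case: ifP; lia.
case: ifP => // /negP nh; apply: ord_inj; rewrite hE.
case: ifP => xN; first lia.
case: nh; apply/hasP.
case: (leqP x.+1 (N.+2 %/ 2)) => le2.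
  by exists x; rewrite ?mem_index_enum // eqxx le2.
exists (h x); rewrite ?mem_index_enum // hK eqxx orbT andbT hE xN.
lia.
Qed.

Lemma dihedral_perm_sub N : dihedral_perm N.+2 \subset rotations N :|: reflections N.
Proof.
pose G := group (group_set_rot_refl N).
suff : dihedral_perm N.+2 \subset G by [].
rewrite gen_subG.
apply/subsetP => g /set2P[->|->]; apply/setUP.
  by left; apply/rotationsP; exists 1; apply: rot_permE.
by right; apply/reflectionsP; exists (- (1 + 1)); apply: refl_permE.
Qed.

Lemma rotation_in_dihedral N (s : 'I_N.+2) :
  exists2 g, g \in dihedral_perm N.+2 & forall i, g i = i + s.
Proof.
exists (rot_perm N.+2 ^+ s)%g.
  by apply/groupX/mem_gen; rewrite set21.
move=> i; rewrite -[in RHS](natr_Zp s); elim: (nat_of_ord s) => [|k IHk].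
  by rewrite expg0 perm1 addr0.
by rewrite expgSr permM IHk rot_permE -addrA mulrSr.
Qed.

(** * Upper bound: a rotation close to a given permutation *)

Lemma val_add1Zp N (x : 'I_N.+2) :
  (x + 1)%R = (if x.+1 < N.+2 then x.+1 else 0)%N :> nat.
Proof.
rewrite val_addZp (_ : nat_of_ord (1 : 'I_N.+2) = 1%N) // addn1.
by case: ltnP => // geN; have := ltn_ord x; lia.
Qed.

Lemma rotation_near N m (f : 'S_N.+2) :
  (0 < m)%N -> (m * m.+1 <= N.+2)%N ->
  exists2 g, g \in dihedral_perm N.+2 & (linf_dist f g < N.+2 - m)%N.
Proof.
move=> m_gt0 le_mN; pose d := (N.+2 - m)%N.
have le_2m : (2 * m <= N.+2)%N by nia.
have d_gt0 : (0 < d)%N by rewrite /d; lia.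
case: (pickP [pred g in dihedral_perm N.+2 | (linf_dist f g < d)%N]) => [g /andP[]|far].
  by exists g.
exfalso.
have hit (s : 'I_N.+2) : exists i, (d <= `|(f i : nat) - nat_of_ord (i + s)%R|)%N.
  have [g Dg gE] := rotation_in_dihedral _ s.
  have /negbT := far g; rewrite inE /= Dg /= -leqNgt le_linf_dist // => /existsP[i].
  by rewrite gE; exists i.
(* The m(m+1) pairs (a, b) with |a - b| >= d, those with a < b being indexed by
   the k with k.2 <= k.1. The rotation by b - f^-1 a is far from f because of
   the pair (a, b), so phi is onto, hence bijective. *)
pose J := ('I_m * 'I_m.+1)%type.
pose lo (k : J) := (k.2 <= k.1)%N.
pose a (k : J) : 'I_N.+2 := inord (if lo k then k.2 : nat else (k.2).-1 + d)%N.
pose b (k : J) : 'I_N.+2 := inord (if lo k then k.1 + d else k.1)%N.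
have aE k : a k = (if lo k then k.2 : nat else (k.2).-1 + d)%N :> nat.
  rewrite inordK //; case: k => x y; rewrite /lo /d /=.
  have := ltn_ord x; have := ltn_ord y.
  by case: ifP; lia.
have bE k : b k = (if lo k then k.1 + d else k.1)%N :> nat.
  rewrite inordK //; case: k => x y; rewrite /lo /d /=.
  have := ltn_ord x; have := ltn_ord y.
  by case: ifP; lia.
pose phi (k : J) : 'I_N.+2 := b k - (f^-1)%g (a k).
have onto (a0 b0 : 'I_N.+2) : (d <= `|(a0 : nat) - (b0 : nat)|)%N ->
    exists k, a k = a0 /\ b k = b0.
  have lta := ltn_ord a0; have ltb := ltn_ord b0 => le_d.
  have [le_ab|lt_ba] := leqP a0 b0.
    have xP : (b0 - d < m)%N by rewrite /d in le_d *; lia.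
    have yP : (a0 < m.+1)%N by rewrite /d in le_d *; lia.
    exists (Ordinal xP, Ordinal yP).
    have lok : lo (Ordinal xP, Ordinal yP) by rewrite /lo /=; lia.
    by split; apply: ord_inj; rewrite ?aE ?bE lok //=; lia.
  have xP : (b0 < m)%N by rewrite /d in le_d *; lia.
  have yP : ((a0 - d).+1 < m.+1)%N by rewrite /d in le_d *; lia.
  exists (Ordinal xP, Ordinal yP).
  have lok : lo (Ordinal xP, Ordinal yP) = false by rewrite /lo /=; lia.
  by split; apply: ord_inj; rewrite ?aE ?bE lok //=; lia.
have surj s : exists k, phi k = s.
  have [i /onto[k [ak bk]]] := hit s.
  by exists k; rewrite /phi ak bk permK addrC addKr.
have inj : injective phi.
  suff /image_injP inj : #|image phi predT| == #|{: J}| by move=> x y; apply: inj.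
  rewrite eqn_leq leq_image_card /=.
  have -> : #|image phi predT| = N.+2.
    rewrite -[RHS]card_ord; apply: eq_card => s; rewrite [RHS]inE.
    by have [k <-] := surj s; apply: image_f.
  by rewrite card_prod !card_ord.
(* The shifts due to pairs with a < b are closed under successor: beyond b = n - 1
   comes the shift - f^-1 a, and if this were due to a pair (a', b') with b' < a'
   then (a', b' - 1), or a' = a when b' = 0, would contradict injectivity. *)
have step s : (exists2 k, lo k & phi k = s) -> exists2 k, lo k & phi k = s + 1.
  case=> -[x y] lok phik.
  have [ltx|gex] := ltnP x.+1 m.
    have lok' : lo (Ordinal ltx, y) by move: lok; rewrite /lo /=; lia.
    exists (Ordinal ltx, y) => //.
    rewrite -phik /phi addrAC; congr (_ - _).
      apply: ord_inj; rewrite val_add1Zp !bE lok lok' /=.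
      by case: ifP; have := ltn_ord x; rewrite /d; lia.
    by congr (_ _); apply: ord_inj; rewrite !aE lok lok'.
  have xm := ltn_ord x.
  have s1 : s + 1 = - (f^-1)%g (a (x, y)).
    rewrite -phik /phi addrAC; suff -> : b (x, y) + 1 = 0 by rewrite sub0r.
    apply: ord_inj; rewrite val_add1Zp !bE lok /=.
    by case: ifP; have := ltn_ord x; rewrite /d; lia.
  have [[x' y'] phik'] := surj (s + 1).
  have [lok'|hik'] := boolP (lo (x', y')); first by exists (x', y').
  have ym := ltn_ord y; have ym' := ltn_ord y'.
  have [x0|x0] := posnP x'.
    move: phik'; rewrite s1 /phi (_ : b _ = 0); last first.
      by apply: ord_inj; rewrite bE (negPf hik').
    rewrite sub0r => /oppr_inj/perm_inj/(congr1 (@nat_of_ord _)).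
    by rewrite !aE lok (negPf hik') /=; move: lok hik'; rewrite /lo /d /=; lia.
  have xP : (x'.-1 < m)%N by have := ltn_ord x'; lia.
  have hik2 : lo (Ordinal xP, y') = false by move: hik'; rewrite /lo /=; lia.
  have /inj E : phi (Ordinal xP, y') = phi (x, y).
    apply: (@addIr _ 1); rewrite [in RHS]phik -phik' /phi addrAC; congr (_ - _).
      apply: ord_inj; rewrite val_add1Zp !bE (negPf hik') hik2 /=.
      by have := ltn_ord x'; case: ifP; lia.
    by congr (_ _); apply: ord_inj; rewrite !aE (negPf hik') hik2.
  by move: lok; rewrite -E hik2.
(* Iterating [step] from the pair [(0, 0)] reaches every shift, so by injectivity every pair would
   satisfy [lo]; the pair [(0, 1)] does not. *)
have all_lo u : exists2 k, lo k & phi k = phi (Ordinal m_gt0, ord0) + u%:R.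
  elim: u => [|u IHu]; last by rewrite mulrSr addrA; apply: step.
  by exists (Ordinal m_gt0, ord0); rewrite ?addr0.
have y1 : (1 < m.+1)%N by [].
have [k lok] := all_lo (phi (Ordinal m_gt0, Ordinal y1) - phi (Ordinal m_gt0, ord0)).
by rewrite natr_Zp addrC subrK => /inj E; move: lok; rewrite E.
Qed.

(** * Lower bound: permutations far from the group *)

(** Here and in [refl_nat], [u] is the position sent to 0. *)
Definition rot_nat (n u i : nat) : nat := (if u <= i then i - u else i + n - u)%N.
Definition refl_nat (n u i : nat) : nat := (if i <= u then u - i else u + n - i)%N.

Definition far_from_dihedral n d (f : 'S_n) : Prop :=
  forall u, (u < n)%N ->
  (exists i, d <= `|(f i : nat) - rot_nat n u i|)%N /\
  (exists i, d <= `|(f i : nat) - refl_nat n u i|)%N.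

Lemma val_subZp N (x y : 'I_N.+2) :
  (x - y)%R = (if y <= x then x - y else x + N.+2 - y)%N :> nat.
Proof.
rewrite val_addZp val_oppZp; have := ltn_ord x; have := ltn_ord y.
by case: eqP; case: (leqP y x); case: ifP; lia.
Qed.

Lemma far_from_dihedral_dist N d (f g : 'S_N.+2) :
  far_from_dihedral _ d f -> g \in dihedral_perm N.+2 -> (d <= linf_dist f g)%N.
Proof.
move=> farf /(subsetP (dihedral_perm_sub _))/setUP[/rotationsP|/reflectionsP] [s gE].
  have [[i le_d] _] := farf _ (ltn_ord (- s)).
  apply: leq_trans le_d _; apply: leq_trans (leq_bigmax i).
  by rewrite gE -[s in i + s]opprK val_subZp.
have [_ [i le_d]] := farf _ (ltn_ord s).
apply: leq_trans le_d _; apply: leq_trans (leq_bigmax i).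
by rewrite gE val_subZp.
Qed.

Lemma far_from_dihedral_le n d e (f : 'S_n) :
  (d <= e)%N -> far_from_dihedral n e f -> far_from_dihedral n d f.
Proof.
move=> le_de farf u /farf[[i le_i] [j le_j]].
by split; [exists i|exists j]; apply: leq_trans le_de _.
Qed.

(* Delete a position [x] with middle value [f x = m] from the circle; every
   rotation or reflection of the shorter circle extends to the longer one,
   changing neither the order of positions nor that of values. *)
Lemma far_from_dihedral_pred n m (f : 'S_n.+1) :
  (2 * m <= n)%N -> far_from_dihedral _ (n.+1 - m) f ->
  exists f' : 'S_n, far_from_dihedral _ (n - m) f'.
Proof.
move=> le_2m farf.
have m_lt : (m < n.+1)%N by lia.
pose y := Ordinal m_lt; pose x := (f^-1)%g y.
have fx : f x = y by rewrite permKV.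
have neq i : y != f (lift x i).
  by rewrite -fx (inj_eq perm_inj) neq_lift.
pose f0 i := s2val (unlift_some (neq i)).
have f0E i : f (lift x i) = lift y (f0 i) by exact: s2valP (unlift_some (neq i)).
have f0_inj : injective f0.
  by move=> i j E; apply: (@lift_inj _ x); apply: (@perm_inj _ f); rewrite !f0E E.
exists (perm f0_inj) => u ltu.
have ltx := ltn_ord x.
have hit (h1 h : nat -> nat) : (forall i, i < n -> h i < n)%N ->
    (forall i, i < n -> h i <= h1 (bump x i) <= (h i).+1)%N ->
    (h1 x < n.+1)%N ->
    (exists i, n.+1 - m <= `|(f i : nat) - h1 i|)%N ->
    (exists i, n - m <= `|(perm f0_inj i : nat) - h i|)%N.
  move=> ltn_h near lt_h1 [i1].
  (* The position [x] is never a witness: [m] is within [n - m] of every value, as [2 * m <= n].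
     Elsewhere low values stay and high ones drop by 1, so the distance loses at most 1. *)
  case: (unliftP x i1) => [i|] ->; last by rewrite fx /=; lia.
  rewrite f0E /= => le_d; exists i; rewrite permE.
  have /= := near i (ltn_ord i); have := ltn_h i (ltn_ord i); have := ltn_ord (f0 i).
  by move: le_d; rewrite /bump; case: leqP => /=; lia.
have lt1 : ((if (u <= x)%N then u else u.+1) < n.+1)%N by case: ifP; lia.
have lt2 : ((if (u < x)%N then u else u.+1) < n.+1)%N by case: ifP; lia.
have [rot_hit _] := farf _ lt1.
have [_ refl_hit] := farf _ lt2.
split.
  apply: hit rot_hit => [i|i|]; rewrite /rot_nat /bump; repeat case: ifP; lia.
apply: hit refl_hit => [i|i|]; rewrite /refl_nat /bump; repeat case: ifP; lia.
Qed.

Lemma perm_extend (K T : finType) (p v : K -> T) :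
  injective p -> injective v -> exists f : {perm T}, forall k, f (p k) = v k.
Proof.
move=> p_inj v_inj.
suff [f fP] : exists f : {perm T}, {in enum K, forall k, f (p k) = v k}.
  by exists f => k; rewrite fP ?mem_enum.
elim: (enum K) (enum_uniq K) => [|k s IHs] /=; first by exists 1%g.
case/andP=> ks /IHs[f fP]; exists (f * tperm (f (p k)) (v k))%g => j.
rewrite permM inE => /predU1P[->|js]; first by rewrite tpermL.
have kj : k != j by apply: contraNneq ks => ->.
by rewrite (fP j) // tpermD // ?(inj_eq v_inj) // -(fP j js) (inj_eq perm_inj) (inj_eq p_inj).
Qed.

(* The position [p j] gets the high value [n - m + j] and the position [q j] the
   low value [m - 1 - j]: an isometry is at distance at least [n - m] at [p j]
   (at [q j]) if its value there is among the [j + 1] least (greatest). *)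
Lemma far_from_dihedral_positions n m (p q : nat -> nat) :
  (2 * m <= n)%N ->
  (forall j, j < m -> p j < n)%N -> (forall j, j < m -> q j < n)%N ->
  (forall i j, i < m -> j < m -> p i = p j -> i = j)%N ->
  (forall i j, i < m -> j < m -> q i = q j -> i = j)%N ->
  (forall i j, i < m -> j < m -> p i <> q j)%N ->
  (forall u, u < n -> exists2 j, j < m &
     rot_nat n u (p j) <= j \/ n <= rot_nat n u (q j) + j.+1)%N ->
  (forall u, u < n -> exists2 j, j < m &
     refl_nat n u (p j) <= j \/ n <= refl_nat n u (q j) + j.+1)%N ->
  exists f : 'S_n, far_from_dihedral _ (n - m) f.
Proof.
move=> le_2m lt_p lt_q p_inj q_inj pq rot_cover refl_cover.
have hiP (j : 'I_m) : (n - m + j < n)%N by have := ltn_ord j; lia.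
have loP (j : 'I_m) : (m.-1 - j < n)%N by have := ltn_ord j; lia.
pose pos (k : 'I_m + 'I_m) : 'I_n := match k with
  | inl j => Ordinal (lt_p _ (ltn_ord j)) | inr j => Ordinal (lt_q _ (ltn_ord j)) end.
pose vals (k : 'I_m + 'I_m) : 'I_n := match k with
  | inl j => Ordinal (hiP j) | inr j => Ordinal (loP j) end.
have pos_inj : injective pos.
  move=> [] i [] j /(congr1 (@nat_of_ord _)) /= E.
  - by congr inl; apply: ord_inj; apply: p_inj E.
  - by case: (pq i j).
  - by case: (pq j i).
  - by congr inr; apply: ord_inj; apply: q_inj E.
have vals_inj : injective vals.
  move=> [] i [] j /(congr1 (@nat_of_ord _)) /= E; have := ltn_ord i; have := ltn_ord j.
  - by move=> *; congr inl; apply: ord_inj; lia.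
  - by lia.
  - by lia.
  - by move=> *; congr inr; apply: ord_inj; lia.
have [f fE] := perm_extend _ _ _ _ pos_inj vals_inj.
have hit h : (exists2 j, j < m & h (p j) <= j \/ n <= h (q j) + j.+1)%N ->
    (exists i, n - m <= `|(f i : nat) - h i|)%N.
  case=> j ltj [le_h|le_h].
    by exists (pos (inl (Ordinal ltj))); rewrite fE /=; lia.
  by exists (pos (inr (Ordinal ltj))); rewrite fE /=; lia.
exists f => u ltu; split; apply: hit.
  exact: rot_cover.
exact: refl_cover.
Qed.

(** * Triangular gaps and the pronic case *)

Definition tri (j : nat) : nat := 'C(j.+1, 2).

Lemma triS j : tri j.+1 = (tri j + j.+1)%N.
Proof. by rewrite /tri binS bin1. Qed.

Lemma tri_double j : (2 * tri j = j * j.+1)%N.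
Proof. by elim: j => // j IHj; rewrite triS; lia. Qed.

Lemma ltn_tri i j : (i < j)%N -> (tri i + i < tri j)%N.
Proof.
elim: j => // j IHj; rewrite ltnS leq_eqVlt triS => /predU1P[->|/IHj]; lia.
Qed.

(** By [triS] the blocks from [tri j] to [tri j + j] tile the naturals; this selects the arc
    covering a given [u]. *)
Lemma tri_floor v : exists2 j, (tri j <= v)%N & (v <= tri j + j)%N.
Proof.
elim: v => [|v [j le1 le2]]; first by exists 0%N.
case: (leqP v.+1 (tri j + j)) => le3; first by exists j; lia.
by exists j.+1; rewrite triS; lia.
Qed.

Lemma far_from_dihedral_pronic m : (4 <= m)%N ->
  exists f : 'S_(m * m.-1), far_from_dihedral _ (m * m.-1 - m) f.
Proof.
case: m => [|[|[|[|c]]]] // _.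
set m := c.+4; set n := (m * m.-1)%N.
pose h := tri m.-1.
have nE : n = (2 * h)%N by have := tri_double c.+3; rewrite /n /h /m /=; lia.
have hE1 : h = (tri c.+2 + c.+3)%N by exact: triS.
have hE2 : tri c.+2 = (tri c.+1 + c.+2)%N by exact: triS.
have hE0 : tri c.+3 = h by [].
have t0 : tri 0 = 0%N by [].
have t1 : tri 1 = 1%N by [].
have t2 : tri 2 = 3%N by [].
have le_2m : (2 * m <= n)%N by rewrite mulnC leq_mul2l.
(* The arcs [p j, p j + j] and [q j - 1 - j, q j - 1], respectively [p j - j, p j]
   and [q j + 1, q j + 1 + j], cover the circle: with triangular gaps the arcs of
   the p j (or q j) abut in one covering and overlap in the other. Near n / 2
   only one of the coverings has room to spare; shifting the last two q j by 1
   and 2 there, and p 0 and q 0 filling two holes, increase n to its full value. *)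
pose p j := (if j == 0 then 2 else if j == 1 then 0 else tri j)%N.
pose q j := (if j == 0 then n.-1 else if j == 1 then 1 else
  if j == c.+3 then h.-1 else if j == c.+2 then n - tri j else n.+1 - tri j)%N.
have tri_mono i j : (i <= j)%N -> (tri i <= tri j)%N.
  by rewrite leq_eqVlt => /predU1P[->//|/ltn_tri]; lia.
have tri_le j : (j < m)%N -> (tri j <= h)%N by move=> ?; apply: tri_mono.
have tri_le2 j : (j < m)%N -> (j != c.+3) -> (tri j <= tri c.+2)%N.
  by move=> *; apply: tri_mono; lia.
have tri_le1 j : (j < m)%N -> (j != c.+3) -> (j != c.+2) -> (tri j <= tri c.+1)%N.
  by move=> *; apply: tri_mono; lia.
have tri_ge j : (1 < j)%N -> (3 <= tri j)%N by move=> ?; rewrite -t2; apply: tri_mono.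
have tri_inj i j : tri i = tri j -> i = j.
  by case: (ltngtP i j) => // /ltn_tri; lia.
have pP j : [\/ j = 0 /\ p j = 2, j = 1 /\ p j = 0 | (1 < j) /\ p j = tri j]%N.
  by rewrite /p; case: j => [|[|j]]; [constructor 1|constructor 2|constructor 3].
have qP j : [\/ j = 0 /\ q j = n.-1, j = 1 /\ q j = 1, j = c.+3 /\ q j = h.-1 |
   (1 < j) /\ (j != c.+3) /\
     (j = c.+2 /\ q j = n - tri j \/ j != c.+2 /\ q j = n.+1 - tri j)]%N.
  rewrite /q; case: j => [|[|j]]; [by constructor 1|by constructor 2|rewrite /=].
  case: eqP => [->|ne1]; first by constructor 3.
  constructor 4; split=> //; split=> //.
  by case: eqP => ne2; [left|right].
have pE j : (1 < j)%N -> p j = tri j by case: (pP j); lia.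
have qE j : (1 < j)%N -> (j < c.+2)%N -> q j = (n.+1 - tri j)%N by case: (qP j); lia.
have qE2 : q c.+2 = (n - tri c.+2)%N by case: (qP c.+2); lia.
have qE3 : q c.+3 = h.-1 by case: (qP c.+3); lia.
have [p0 p1 q0 q1] : [/\ p 0 = 2, p 1 = 0, q 0 = n.-1 & q 1 = 1]%N by [].
clearbody p q n h.
apply: (far_from_dihedral_positions n m p q) => //.
- move=> j jm; have := tri_le j jm; case: (pP j); lia.
- move=> j jm; have := tri_ge j; have := tri_le j jm; case: (qP j); lia.
- move=> i j im jm; have := @tri_inj i j; have := tri_ge i; have := tri_ge j.
  case: (pP i); case: (pP j); lia.
- move=> i j im jm; have := @tri_inj i j; have := tri_ge i; have := tri_ge j.
  have := tri_le1 i im; have := tri_le1 j jm.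
  case: (qP i) => [[? E1]|[? E1]|[? E1]|[? [? [[? E1]|[? E1]]]]];
    case: (qP j) => [[? E2]|[? E2]|[? E2]|[? [? [[? E2]|[? E2]]]]];
    subst; lia.
- move=> i j im jm; have := tri_ge i; have := tri_ge j.
  have := tri_le i im; have := tri_le2 i im; have := tri_le1 j jm.
  case: (pP i) => [[? E1]|[? E1]|[? E1]];
    case: (qP j) => [[? E2]|[? E2]|[? E2]|[? [? [[? E2]|[? E2]]]]]; subst; try lia.
  by case: (eqVneq i c.+3) => [E|]; subst; lia.
(* Rotations: the [p j] cover up to [h]; the arcs of [q c.+3] and [q c.+2] abut and reach
   [h + 2 * c.+3]; the smaller [q j] cover the rest. *)
- move=> u un.
  have [u0|u_gt0] := posnP u.
    by exists 1%N => //; left; rewrite u0 p1.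
  have [le_uh|lt_hu] := leqP u h.
    have [i le1 le2] := tri_floor u.-1.
    have i_lt : (i < c.+3)%N by rewrite ltnNge; apply/negP => /tri_mono; lia.
    have [i0|i_gt0] := posnP i.
      by exists 2%N => //; left; rewrite pE // /rot_nat t2; subst i; case: ifP; lia.
    by exists i.+1 => //; left; rewrite pE // /rot_nat triS; case: ifP; lia.
  have [le_u1|lt_1u] := leqP u (h + c.+3).
    by exists c.+3 => //; right; rewrite qE3 /rot_nat; case: ifP; lia.
  have [le_u2|lt_2u] := leqP u (h + 2 * c.+3).
    by exists c.+2 => //; right; rewrite qE2 /rot_nat; case: ifP; lia.
  have hE3 : tri c.+1 = (tri c + c.+1)%N by exact: triS.
  have [i le1 le2] := tri_floor (n - u).+1.
  have i_lt : (i < c.+1)%N by rewrite ltnNge; apply/negP => /tri_mono; lia.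
  have i_gt0 : (0 < i)%N by case: i le1 le2 {i_lt} => //; lia.
  by exists i.+1; [lia|right]; rewrite qE // /rot_nat triS; case: ifP; lia.
(* Reflections: the arcs of the [p j] reach [h + c.+3] and those of the [q j] with [j < c.+2] take
   over there, which leaves the last two [q j] free to be shifted. *)
- move=> u un.
  have [u1|u_gt1] := leqP u 1.
    by exists 1%N => //; left; rewrite p1 /refl_nat /=; lia.
  have [->|u2] := eqVneq u 2%N; first by exists 0%N => //; left; rewrite p0.
  have [le_u|lt_u] := leqP u (h + c.+3).
    have [i le1 le2] := tri_floor u.
    have i_lt : (i < c.+4)%N.
      by rewrite ltnNge; apply/negP => /tri_mono; rewrite triS; lia.
    have i_gt1 : (1 < i)%N by case: i le1 le2 {i_lt} => [|[|i]] //; lia.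
    by exists i => //; left; rewrite pE // /refl_nat; case: ifP; lia.
  have [u1|u_neq1] := eqVneq u n.-1.
    by exists 1%N => //; right; rewrite q1 /refl_nat; case: ifP; lia.
  have [u2'|u_neq2] := eqVneq u n.-2.
    by exists 0%N => //; right; rewrite q0 /refl_nat; case: ifP; lia.
  have [i le1 le2] := tri_floor (n - u).
  have i_lt : (i < c.+2)%N by rewrite ltnNge; apply/negP => /tri_mono; lia.
  have i_gt1 : (1 < i)%N by case: i le1 le2 {i_lt} => [|[|i]] //; lia.
  by exists i; [lia|right]; rewrite qE // /refl_nat; case: ifP; lia.
Qed.

(* Distances are written with truncated subtractions, so that they compute. *)
Lemma far_from_dihedral_seq n d (s : seq nat) :
  perm_eq s (iota 0 n) ->
  all (fun u =>
      has (fun i => d <= (nth 0 s i - rot_nat n u i) +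
                         (rot_nat n u i - nth 0 s i)) (iota 0 n) &&
      has (fun i => d <= (nth 0 s i - refl_nat n u i) +
                         (refl_nat n u i - nth 0 s i)) (iota 0 n))%N
    (iota 0 n) ->
  exists f : 'S_n, far_from_dihedral n d f.
Proof.
move=> s_perm /allP far.
have s_size : size s = n by rewrite (perm_size s_perm) size_iota.
have lt_s i : (i < n)%N -> (nth 0 s i < n)%N.
  move=> lt_i; have : nth 0%N s i \in iota 0 n by rewrite -(perm_mem s_perm) mem_nth ?s_size.
  by rewrite mem_iota.
pose f0 (i : 'I_n) := Ordinal (lt_s i (ltn_ord i)).
have f0_inj : injective f0.
  move=> i j /(congr1 (@nat_of_ord _)) /= /eqP; rewrite nth_uniq ?s_size //.
    by move/eqP/ord_inj.
  by rewrite (perm_uniq s_perm) iota_uniq.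
exists (perm f0_inj) => u ltu; have /far/andP[] : u \in iota 0 n by rewrite mem_iota.
by move=> /hasP[i + le_i] /hasP[j + le_j]; rewrite !mem_iota /= => lti ltj;
  split; [exists (Ordinal lti)|exists (Ordinal ltj)]; rewrite permE /=; lia.
Qed.

(** From the pronic size [m * m.-1], positions are deleted one at a time down to [n]; sizes up to 7
    get explicit permutations. *)
Lemma far_from_dihedral_exists n m :
  (3 <= n)%N -> (m.-1 * m.-2 <= n <= m * m.-1)%N ->
  exists f : 'S_n, far_from_dihedral n (n - m) f.
Proof.
move=> n_ge3 /andP[ge_n le_n].
have m_ge3 : (2 < m)%N by nia.
have [n_le7|n_gt7] := leqP n 7.
  (* As [m >= 3], distance [n - 3] suffices; [n = 7] forces [m >= 4], hence 3. *)
  have [f farf] : exists f : 'S_n, far_from_dihedral n (if n == 7 then 3 else n - 3)%N f.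
    move: n n_ge3 n_le7 {ge_n le_n} => [|[|[|[|[|[|[|[|n]]]]]]]] // _ _ /=.
    - by apply: (far_from_dihedral_seq _ _ [:: 0; 1; 2]%N).
    - by apply: (far_from_dihedral_seq _ _ [:: 0; 1; 3; 2]%N).
    - by apply: (far_from_dihedral_seq _ _ [:: 0; 2; 3; 1; 4]%N).
    - by apply: (far_from_dihedral_seq _ _ [:: 0; 2; 3; 4; 1; 5]%N).
    - by apply: (far_from_dihedral_seq _ _ [:: 0; 1; 3; 4; 5; 2; 6]%N).
  exists f; apply: far_from_dihedral_le farf.
  by case: eqP => [n7|]; nia.
have m_ge4 : (4 <= m)%N by nia.
(* Deletion requires this bound; at [m = 4] it means [n >= 8], whence the cutoff. *)
have le_2m : (2 * m <= n)%N by case: (ltnP m 5); nia.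
have [k kE] : exists k, (m * m.-1 = k + n)%N by exists (m * m.-1 - n)%N; lia.
have [f0 farf0] := far_from_dihedral_pronic m m_ge4.
have [f' farf'] : exists f : 'S_(k + n), far_from_dihedral _ (k + n - m) f.
  by rewrite -kE; exists f0.
elim: k f' farf' {kE} => [|k IHk] f' farf'; first by exists f'.
have [|f farf] := @far_from_dihedral_pred (k + n) m f' _ farf'; first lia.
exact: IHk farf.
Qed.

(** * The floor expression and the conclusion *)

(** Square [2k - 1 <= s < 2k + 1], where [s] is the root of [4n + 1]. *)
Lemma floor_pronic (R : realType) n
    (k := Num.floor ((Num.sqrt (4 * n%:R + 1) + 1) / 2 : R)) :
  [/\ 0 < k, k * (k - 1) <= n%:Z & n%:Z < k * (k + 1)].
Proof.
set s := Num.sqrt (4 * n%:R + 1 : R).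
have n0 : 0 <= n%:R :> R by [].
have s2 : s ^+ 2 = 4 * n%:R + 1 by rewrite sqr_sqrtr //; lra.
have s0 : 0 <= s by exact: sqrtr_ge0.
have s1 : 1 <= s by nra.
have /andP[le_k lt_k] := floor_itv ((s + 1) / 2).
rewrite -/k in le_k lt_k; rewrite intrD in lt_k.
have k0 : 0 < k.
  by rewrite -(ltr_int R); lra.
have k1 : 1 <= k%:~R :> R by rewrite (ler_int R 1).
split=> //.
  rewrite -(ler_int R) intrM intrB -[n%:~R]/(n%:R); nra.
rewrite -(ltr_int R) intrM intrD -[n%:~R]/(n%:R); nra.
Qed.

Theorem theoremV2 (R : realType) (n : nat) (n_ge3 : (3 <= n)%N) :
  let r : int := (covering_radius (dihedral_perm n))%:Z in
  let k : int := Num.floor ((Num.sqrt (4 * n%:R + 1) + 1) / 2 : R) in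
  (n%:Z - k >= r /\ r >= n%:Z - k - 1) /\
  (forall m : int, 0 < m -> n%:Z = m * (m - 1) -> r = n%:Z - m).
Proof.
move=> r k; have [] := floor_pronic R n; rewrite -/k.
case: k => // k k_gt0 le_kZ lt_kZ.
have k_gt1 : (1 < k)%N by nia.
have le_kn : (k.-1 * k <= n)%N by nia.
have lt_nk : (n < k * k.+1)%N by nia.
have D0 : dihedral_perm n != set0 :> {set 'S_n}.
  by apply/set0Pn; exists 1%g; apply: group1.
have upper : (covering_radius (dihedral_perm n) <= n - k)%N.
  apply/(covering_radius_le _ _ _ D0) => f.
  case: n n_ge3 f le_kn {r lt_nk le_kZ lt_kZ D0} => [|[|N]] // _ f le_kn.
  (* The strict bound [n - k.-1] gives [n - k]. *)
  have [||g Dg lt_g] := rotation_near N k.-1 f; [lia|rewrite prednK //; lia|].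
  by exists g => //; lia.
have lower m : (m.-1 * m.-2 <= n <= m * m.-1)%N ->
    (n - m <= covering_radius (dihedral_perm n))%N.
  move=> /(far_from_dihedral_exists _ _ n_ge3)[f farf].
  have /(covering_radius_le _ _ _ D0) /(_ f) [g Dg] :=
    leqnn (covering_radius (dihedral_perm n)).
  apply: leq_trans.
  case: n n_ge3 f farf g Dg {r le_kZ lt_kZ le_kn lt_nk D0 upper} =>
    [|[|N]] // _ f farf g.
  exact: far_from_dihedral_dist farf.
rewrite /r; split.
  split; first by nia.
  have := lower k.+1; rewrite [(k * _)%N]mulnC le_kn mulnC ltnW // => /(_ isT); lia.
move=> [m|//] m_gt0 nE.
(* A pronic [n] is the top of the range of [lower k], which gains 1 over [lower k.+1]. *)
have mk : m = k by nia.
have nEk : n = (k * k.-1)%N by nia.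
have ge_k : (k <= n)%N by rewrite nEk leq_pmulr //; lia.
have : (n - k <= covering_radius (dihedral_perm n))%N.
  by apply: lower; rewrite {1}nEk leq_mul ?leq_pred //= nEk.
by rewrite mk; lia.
Qed.
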